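(* Let $\lambda$ be an infinite regular cardinal, suppose there exists a tight strongly unbounded coloring $c:\lambda\times\lambda^+\rightarrow\lambda$, and let $\mathcal S$ be a partition of $E^{\lambda^+}_{\lambda}$ into stationary sets. Then $\clubsuit_{\mathrm{ad}^*}(\mathcal S,\lambda,{<}\lambda)$ holds.
   Context: $E^{\lambda^+}_\lambda=\{\alpha<\lambda^+\mid\mathrm{cf}(\alpha)=\lambda\}$. For a coloring $c:\lambda\times\kappa\rightarrow\lambda$ (here $\kappa=\lambda^+$) and $\beta<\kappa$, $c_\beta(\eta):=c(\eta,\beta)$. $c$ is strongly unbounded iff for every cofinal $B\subseteq\kappa$ there are $\eta<\lambda$ and $t:\eta\to\lambda$ with $\sup\{c_\beta(\eta)\mid\beta\in B,\ c_\beta\restriction\eta=t\}=\lambda$. For $\mathbb T\subseteq{}^{<\lambda}\lambda$, $[\mathbb T]_c:=\{\beta<\kappa\mid\forall\eta<\lambda\,(c_\beta\restriction\eta\in\mathbb T)\}$, $\mathcal T_c:=\{\mathbb T\subseteq{}^{<\lambda}\lambda\mid\sup([\mathbb T]_c)=\kappa\}$; $c$ is tight iff there is $\mathcal D\subseteq\mathcal T_c$ of size $\le\kappa$ such that every member of $\mathcal T_c$ contains a member of $\mathcal D$. For a regular uncountable $\kappa$, a collection $\mathcal S$ of stationary subsets of $\kappa$ and nonzero cardinals $\mu,\theta<\kappa$, $\clubsuit_{\mathrm{ad}^*}(\mathcal S,\mu,{<}\theta)$ asserts the existence of $\langle\mathcal A_\alpha\mid\alpha\in\bigcup\mathcal S\rangle$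 such that: (i) for every limit ordinal $\alpha\in\bigcup\mathcal S$, $\mathcal A_\alpha$ is a pairwise disjoint family of $\mu$ many cofinal subsets of $\alpha$; (ii) for every $\mathcal B\subseteq[\kappa]^\kappa$ of size $<\theta$ and every $S\in\mathcal S$, there are stationarily many $\alpha\in S$ with $\sup(A\cap B)=\alpha$ for all $A\in\mathcal A_\alpha$, $B\in\mathcal B$; (iii) for all distinct $A,A'$ from $\bigcup_{S\in\mathcal S}\bigcup_{\alpha\in S}\mathcal A_\alpha$, $|A\cap A'|<\mathrm{cf}(\sup(A))$. *)

(* Defs.v *)
From mathcomp Require Import all_boot all_order.
From mathcomp Require Import all_classical.
From mathcomp Require wochoice.

Set Implicit Arguments.
Unset Strict Implicit.
Unset Printing Implicit Defensive.

Import Order.TTheory.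
Local Open Scope classical_set_scope.
Local Open Scope card_scope.
Local Open Scope order_scope.

(* An ordinal is represented by a well-ordered type X.  The ordinals below X
   are the elements of X.  An ordinal <= X is also identified, as usual, with
   the set of its predecessors: a : X with [below a], and X itself with
   [set: X]. *)

Definition card_lt T U (A : set T) (B : set U) : bool :=
  (A #<= B) && ~~ (B #<= A).

Section Ordinals.
Context {d : Order.disp_t} {X : orderType d}.
Implicit Types (A C D S : set X) (a x : X).

Definition below a : set X := [set x | x < a].

(* sup A, as the set of ordinals smaller than sup A; it is defined for every
   A, including those unbounded in X, for which it is [set: X]. *)
Definition osup A : set X := [set x | exists2 a, A a & x < a].

Lemma osup_below A a : osup A = below a <-> supremums A a.
Proof.
split=> [/seteqP[sub1 sub2]|[ub lb]].
  split=> [b Ab|u ubu].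
    rewrite leNgt; apply/negP => ab.
    by have := sub1 a (ex_intro2 _ _ b Ab ab); rewrite /below /= ltxx.
  rewrite leNgt; apply/negP => ua.
  by have [b Ab] := sub2 u ua; rewrite ltNge ubu.
apply/seteqP; split=> [x [b Ab xb]|x xa]; first exact: lt_le_trans xb (ub b Ab).
apply: contrapT => nx; have : a <= x.
  by apply: lb => b Ab; rewrite leNgt; apply/negP => xb; apply: nx; exists b.
by rewrite leNgt xa.
Qed.

Lemma osup_setT A : osup A = [set: X] <-> ~ has_ubound A.
Proof.
split=> [eA [u ubu]|nub].
  have [b Ab] : osup A u by rewrite eA.
  by rewrite ltNge ubu.
apply/seteqP; split=> // x _; apply: contrapT => nx; apply: nub.
by exists x => b Ab; rewrite leNgt; apply/negP => xb; apply: nx; exists b.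
Qed.

Definition cofinal_in D A : Prop :=
  A `<=` D /\ forall x, D x -> exists2 a, A a & x <= a.

(* cf(D) = |M|, for an initial segment D of X; cf(D) is the least cardinality
   of a cofinal subset of D. *)
Definition is_cf D U (M : set U) : Prop :=
  (exists2 A, cofinal_in D A & A #= M) /\
  (forall A, cofinal_in D A -> M #<= A).

Definition limit a : Prop :=
  (exists x, x < a) /\ (forall x, x < a -> exists2 y, x < y & y < a).

Definition club C : Prop :=
  osup C = [set: X] /\
  forall a, limit a -> osup (C `&` below a) = below a -> C a.

Definition stationary S : Prop := forall C, club C -> S `&` C !=set0.

End Ordinals.

Definition initial_ordinal (d : Order.disp_t) (X : orderType d) : Prop :=
  wochoice.well_order (<=%O : rel X) /\
  forall x : X, card_lt (below x) [set: X].

Definition infinite_regular_cardinal (d : Order.disp_t) (L : orderType d)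
    : Prop :=
  [/\ initial_ordinal L, infinite_set [set: L] & is_cf [set: L] [set: L]].

(* K is the least ordinal of cardinality greater than |L| *)
Definition successor_cardinal (d d' : Order.disp_t) (L : orderType d)
    (K : orderType d') : Prop :=
  [/\ wochoice.well_order (<=%O : rel K), card_lt [set: L] [set: K] &
      forall x : K, below x #<= [set: L]].

Section Colorings.
Context {d d' : Order.disp_t} {L : orderType d} {K : orderType d'}.
Implicit Types (c : L -> K -> L).

Definition lseq (eta : L) : Type := {x : L | x < eta} -> L.

(* ^{<L}L: the functions from some eta < L to L *)
Definition lseqs : Type := {eta : L & lseq eta}.

Definition crestr c (b : K) (eta : L) : lseq eta := fun x => c (val x) b.
Arguments crestr : clear implicits.

Definition strongly_unbounded c : Prop :=
  forall B : set K, cofinal_in [set: K] B ->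
  exists (eta : L) (t : lseq eta),
    osup [set c eta b | b in [set b | B b /\ crestr c b eta = t]]
      = [set: L].

Definition branches c (T : set lseqs) : set K :=
  [set b | forall eta : L, T (existT _ eta (crestr c b eta))].

Definition Tfam c : set (set lseqs) :=
  [set T | osup (branches c T) = [set: K]].

Definition tight c : Prop :=
  exists DD : set (set lseqs),
    [/\ DD `<=` Tfam c, DD #<= [set: K] &
        forall T, Tfam c T -> exists2 D, DD D & D `<=` T].

(* E^K_L *)
Definition Ecf : set K := [set a | is_cf (below a) [set: L]].

End Colorings.

Arguments Ecf {d d'} L K.
Arguments crestr {d d' L K} c b eta _.

Definition stationary_partition (d : Order.disp_t) (K : orderType d)
    (SS : set (set K)) (E : set K) : Prop :=
  [/\ forall S, SS S -> stationary S,
      trivIset SS id &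
      \bigcup_(S in SS) S = E].

(* The cardinals mu and theta are given by types M and Th of that size. *)
Definition clubsuit_ad_star (d : Order.disp_t) (K : orderType d)
    (SS : set (set K)) (M Th : Type) : Prop :=
  exists AA : K -> set (set K),
  [/\ forall a, (\bigcup_(S in SS) S) a -> limit a ->
        [/\ trivIset (AA a) id,
            AA a #= [set: M] &
            forall A, AA a A -> cofinal_in (below a) A],
      forall BB : set (set K),
        (forall B, BB B -> B #= [set: K]) -> card_lt BB [set: Th] ->
        forall S, SS S ->
        stationary [set a | S a /\
          forall A B, AA a A -> BB B -> osup (A `&` B) = below a] &
      forall A A' : set K,
        (\bigcup_(S in SS) \bigcup_(a in S) AA a) A ->
        (\bigcup_(S in SS) \bigcup_(a in S) AA a) A' ->
        A <> A' ->
        exists2 C : set K, is_cf (osup A) C & card_lt (A `&` A') C].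

(* Main.v *)
Require Import Defs.
From mathcomp Require Import all_boot all_order.
From mathcomp Require Import all_classical.
From Stdlib Require Import Wellfounded Relation_Operators.

Set Implicit Arguments.
Unset Strict Implicit.
Unset Printing Implicit Defensive.

Import Order.TTheory.
Local Open Scope classical_set_scope.
Local Open Scope card_scope.
Local Open Scope order_scope.

(* Fix injections [e_a : a -> L].  Put [e'_a(b) = min_(b < x < a) max (e_x(b),
   e_a(x))]; every [e'_a] is (<L)-to-one.  To [a] in [E^K_L] attach
   [x >= a] and the set [A] of all [b < a] with
   [e'_a(b) <= c_x(Delta(c_x, c_b))], where [Delta] is the first difference.
   If [c_x] and [c_x'] differ at [z], a common element [b] of the sets attached
   to [(a, x)] and [(a', x')] splits from [c_x] or from [c_x'] at most at [z],
   so the two sets have fewer than L common elements.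
   For the guessing, strong unboundedness implies that the functions [c_b] have
   only L many initial segments; hence tightness gives, for every unbounded B, a
   tree T of the dense family all of whose nodes lie on [c_b] for unboundedly
   many [b] in B.  Let [x] be a branch of T, and suppose that [A] meets B in a
   set bounded below [a], for stationarily many [a].  By Fodor the bound is a
   fixed [g] for unboundedly many [a]; choose [dl] such that each node of T is
   on [c_b] for some [b] in B between [g] and [dl], and thin out to make
   [e_a(dl)] constant.  Strong unboundedness applied to the [x]'s gives a node
   [t] of T, followed in the [c_x]'s by unboundedly many values; for [b] on [t],
   a large enough value yields [b] in [A], a contradiction.
   To guess fewer than L many sets B, each stationary set is split so that [a]
   treats fewer than L many trees at once, and every such set of trees is
   treated stationarily often.  A ladder is added to [A] so that it is cofinal
   in [a] for every [a]. *)

(** * Cardinal comparison by injections, and greedy recursion *)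

Lemma card_le_fun T U (A : set T) (B : set U) (f : T -> U) :
  (forall x, A x -> B (f x)) ->
  (forall x y, A x -> A y -> f x = f y -> x = y) -> A #<= B.
Proof.
move=> fAB finj; have [g] : $|{injfun A >-> B}|.
  by apply/injfunPex; exists f => // x y /set_mem Ax /set_mem Ay; apply: finj.
exact: inj_card_le g.
Qed.

Lemma card_le_funE T U (u0 : U) (A : set T) (B : set U) : A #<= B ->
  exists f : T -> U, (forall x, A x -> B (f x)) /\
    (forall x y, A x -> A y -> f x = f y -> x = y).
Proof.
elim/Ppointed: U => U in u0 B *; first by case: (no u0).
move=> /pcard_leP[f]; exists f; split=> [x Ax|x y Ax Ay].
  exact: funS.
by apply: 'inj_f; rewrite inE.
Qed.

Lemma card_leX T T' U U' (A : set T) (B : set U) (A' : set T') (B' : set U') :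
  A #<= A' -> B #<= B' -> A `*` B #<= A' `*` B'.
Proof.
move=> AA BB; have [->|/set0P[[x y] [/= Ax By]]] := eqVneq (A `*` B) set0.
  exact: card_ge0.
have [x'] : exists x' : T', True.
  apply: contrapT => nT; move: AA; rewrite (_ : A' = set0) ?card_le0.
    by move=> /eqP A0; rewrite A0 in Ax.
  by rewrite -subset0 => z; case: nT; exists z.
have [y'] : exists y' : U', True.
  apply: contrapT => nT; move: BB; rewrite (_ : B' = set0) ?card_le0.
    by move=> /eqP B0; rewrite B0 in By.
  by rewrite -subset0 => z; case: nT; exists z.
move=> _ _; have [f [fA finj]] := card_le_funE x' AA.
have [g [gB ginj]] := card_le_funE y' BB.
apply: (@card_le_fun _ _ _ _ (fun p => (f p.1, g p.2))) => [[a b] [/= Aa Bb]|].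
  by split; [apply: fA|apply: gB].
move=> [a b] [a' b'] [/= Aa Bb] [/= Aa' Bb'] [/finj-> // /ginj-> //].
Qed.

(** Hilbert's hotel: shifting along a copy [g] of the natural numbers in [A] frees [g 0] for [x]. *)
Lemma infinite_card_setU1 T (A : set T) (x : T) :
  infinite_set A -> A `|` [set x] #<= A.
Proof.
have [Ax _|nAx] := pselect (A x).
  by apply: subset_card_le => y [//|->].
move=> /infiniteP /(card_le_funE x) [g [gA ginj]].
pose s y := if pselect (exists n, g n = y) is left h then g (sval (cid h)).+1
            else y.
have sE n : s (g n) = g n.+1.
  rewrite /s; case: pselect => [h|[]]; last by exists n.
  by case: (cid h) => m /= /ginj ->.
have sN y : (forall n, g n <> y) -> s y = y.
  by rewrite /s; case: pselect => // -[n gn] /(_ n).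
have sP y : A y -> A (s y) /\ s y <> g 0%N.
  move=> Ay; have [[n <-]|ny] := pselect (exists n, g n = y).
    by rewrite sE; split; [apply: gA|move/ginj => /(_ I I)].
  by rewrite sN // => [|n gn]; [split=> // e|]; apply: ny; [exists 0%N|exists n].
have sinj y z : s y = s z -> y = z.
  have [[n <-]|ny] := pselect (exists n, g n = y).
    have [[m <-]|nz] := pselect (exists n, g n = z).
      by rewrite !sE => /ginj -/(_ I I) [->].
    rewrite sE (sN z) => [e|n' gn']; apply: contrapT => _; apply: nz.
      by exists n.+1.
    by exists n'.
  have [[m <-]|nz] := pselect (exists n, g n = z).
    rewrite sE (sN y) => [e|n' gn']; apply: contrapT => _; apply: ny.
      by exists m.+1.
    by exists n'.
  by rewrite !sN // => n gn; [apply: nz|apply: ny]; exists n.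
pose h y := if pselect (y = x) is left _ then g 0%N else s y.
have hx : h x = g 0%N by rewrite /h; case: pselect.
have hN y : A y -> h y = s y.
  by rewrite /h; case: pselect => // -> /nAx.
apply: (@card_le_fun _ _ _ _ h) => [y [Ay|->]|y z].
- by rewrite hN //; case: (sP y Ay).
- by rewrite hx; apply: gA.
move=> [Ay|->] [Az|->]; rewrite ?hx ?hN //; first exact: sinj.
- by case: (sP y Ay).
- by case: (sP z Az) => _ n /esym.
Qed.

(** Transfinite recursion along [R]. The existence assumption covers every [f], so no invariant on
    earlier values is carried; [y0] is returned when no choice exists. *)
Lemma greedy_choice (W Y : Type) (R : W -> W -> Prop) (A : set W)
    (Ok : W -> Y -> Prop) (C : Y -> Y -> Prop) (y0 : Y) :
  well_founded R ->
  (forall w (f : W -> Y), A w ->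
     exists y, Ok w y /\ forall v, A v -> R v w -> C (f v) y) ->
  exists f : W -> Y, forall w, A w ->
    Ok w (f w) /\ forall v, A v -> R v w -> C (f v) (f w).
Proof.
move=> wfR ex.
pose P w (rec : forall v, R v w -> Y) y :=
  Ok w y /\ forall v (h : R v w), A v -> C (rec v h) y.
pose F w (rec : forall v, R v w -> Y) : Y :=
  if pselect (exists y, P w rec y) is left h then sval (cid h) else y0.
pose f := Fix wfR (fun=> Y) F.
have fE w : f w = F w (fun v _ => f v).
  apply: Fix_eq => x g g' gg'; congr F.
  by do 2!(apply: functional_extensionality_dep => ?); apply: gg'.
exists f => w Aw; rewrite fE /F; case: pselect => [h|[]].
  case: (cid h) => y /= [Oky Cy]; split=> // v Av Rvw; exact: Cy.
by have [y [Oky Cy]] := ex w f Aw; exists y; split=> // v h Av; apply: Cy.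
Qed.

(** The values already used at [w] cannot exhaust [D], so a fresh one can always be chosen. *)
Lemma wf_card_le (W Y : Type) (R : W -> W -> Prop) (A : set W) (D : set Y) :
  well_founded R -> (forall v w, v = w \/ R v w \/ R w v) ->
  (forall w, A w -> ~ (D #<= [set v | A v /\ R v w])) -> A #<= D.
Proof.
move=> wfR totR lt; have [->|/set0P[w0 Aw0]] := eqVneq A set0; first exact: card_ge0.
have [D0|/set0P[y0 _]] := eqVneq D set0.
  by have := lt _ Aw0; rewrite D0 => /(_ (card_ge0 _ _)).
have [|f fP] := @greedy_choice W Y R A (fun _ y => D y) (fun y z => y <> z) y0 wfR.
  move=> w f Aw; apply: contrapT => ne; apply: (lt w Aw).
  apply: card_le_trans (card_image_le f _); apply: subset_card_le => y Dy.
  apply: contrapT => ny; apply: ne; exists y; split=> // v Av Rv e.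
  by apply: ny; exists v.
apply: (@card_le_fun _ _ _ _ f) => [w /fP[]//|v w Av Aw e].
have [//|[h|h]] := totR v w.
- by case: (fP w Aw) => _ /(_ v Av h).
- by case: (fP v Av) => _ /(_ w Aw h); rewrite e.
Qed.

(** * Goedel's order on pairs and squares of cardinals *)

Section WellOrder.
Context {d : Order.disp_t} {X : orderType d}.
Context (woX : wochoice.well_order (<=%O : rel X)).

Lemma wo_min (P : X -> Prop) : (exists x, P x) ->
  exists x, P x /\ forall y, P y -> x <= y.
Proof.
move=> [x Px]; have [|z [[/asboolP Pz lb] _]] := woX (A := fun x => `[< P x >]).
  by exists x; apply/asboolP.
by exists z; split=> // y Py; apply: lb; apply/asboolP.
Qed.

Lemma wo_wf : well_founded (fun x y : X => x < y).
Proof.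
move=> a; apply: contrapT => na.
have [x [nx xmin]] := wo_min (ex_intro (fun a => ~ Acc (fun x y : X => x < y) a) a na).
apply: nx; constructor=> y yx; apply: contrapT => /xmin.
by rewrite leNgt yx.
Qed.

(** Goedel's canonical order: maxima are compared first, then the pairs lexicographically. *)
Let key (p : X * X) : X * (X * X) := (Order.max p.1 p.2, p).
Let pair_lt (p q : X * X) :=
  slexprod X (X * X) (fun x y => x < y)
    (slexprod X X (fun x y => x < y) (fun x y => x < y)) (key p) (key q).

Let pair_wf : well_founded pair_lt.
Proof.
apply: wf_inverse_image; apply: wf_slexprod; first exact: wo_wf.
by apply: wf_slexprod; apply: wo_wf.
Qed.

Let pair_total p q : p = q \/ pair_lt p q \/ pair_lt q p.
Proof.
case: p q => [x y] [x' y']; rewrite /pair_lt /key /=.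
case: (ltgtP (Order.max x y) (Order.max x' y')) => e.
- by right; left; left.
- by right; right; left.
rewrite e; case: (ltgtP x x') => e1.
- by right; left; right; left.
- by right; right; right; left.
rewrite e1; case: (ltgtP y y') => e2.
- by right; left; right; right.
- by right; right; right; right.
by left; rewrite e2.
Qed.

Let pair_lt_max p q : pair_lt p q -> Order.max p.1 p.2 <= Order.max q.1 q.2.
Proof.
have le1 R u v : slexprod X (X * X) (fun x y => x < y) R u v -> u.1 <= v.1.
  by case=> [x y x' y' /ltW|x y y' _].
exact: le1.
Qed.

(* In the Goedel order, the pairs before [p] lie in the square of the segment
   bounded by [max p.1 p.2]. *)
Lemma card_square_step (D : set X) : infinite_set D ->
  (forall m, D m -> ~ (D #<= below m)) ->
  (forall m, D m -> infinite_set (below m) ->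
     below m `*` below m #<= below m) ->
  D `*` D #<= D.
Proof.
move=> Dinf Dini sq; apply: (wf_card_le pair_wf pair_total) => -[x y] [/= Dx Dy].
set m := Order.max x y => DS; have Dm : D m by rewrite /m; case: leP.
pose Q := below m `|` [set m].
have {DS}DQ : D #<= Q `*` Q.
  apply: card_le_trans DS _; apply: subset_card_le => -[u v] [_] /pair_lt_max /=.
  rewrite ge_max => /andP[um vm]; split=> /=; rewrite /Q /below /=.
    by move: um; rewrite le_eqVlt => /orP[/eqP|]; [right|left].
  by move: vm; rewrite le_eqVlt => /orP[/eqP|]; [right|left].
(* In both cases [Q * Q] is too small to receive [D]: it is finite, or embeds in [below m]. *)
have [fin|inf] := pselect (finite_set (below m)).
  apply: Dinf; apply: card_le_finite DQ _; apply: finite_setX;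
  by rewrite finite_setU; split=> //; apply: finite_set1.
apply: (Dini _ Dm); apply: card_le_trans DQ _.
apply: card_le_trans (sq _ Dm inf).
by apply: card_leX; apply: infinite_card_setU1.
Qed.

Lemma card_square_below (a : X) :
  infinite_set (below a) -> below a `*` below a #<= below a.
Proof.
elim: (wo_wf a) => {}a _ IH ainf.
(* Either the claim transfers from a smaller [b] of the same size, or [a] is an initial ordinal. *)
have [[b [ba ab]]|nb] := pselect (exists b, b < a /\ below a #<= below b).
  have binf : infinite_set (below b).
    by move=> bfin; apply: ainf; apply: card_le_finite ab bfin.
  apply: card_le_trans (card_leX ab ab) _; apply: card_le_trans (IH b ba binf) _.
  by apply: subset_card_le => x xb; apply: lt_trans xb ba.
apply: card_square_step => // m ma.
  by move=> am; apply: nb; exists m.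
Qed.

Lemma card_square : infinite_set [set: X] ->
  (forall x : X, ~ ([set: X] #<= below x)) -> [set: X * X] #<= [set: X].
Proof.
move=> Xinf Xini; rewrite (_ : [set: X * X] = setT `*` setT); last first.
  by apply/seteqP; split.
by apply: card_square_step => // m _; apply: card_square_below.
Qed.

End WellOrder.

(** * Sets of size less than a regular cardinal *)

(** By comparability of cardinals this says that [A] has size less than [L]. *)
Definition small (d : Order.disp_t) (L : orderType d) T (A : set T) : Prop :=
  ~ ([set: L] #<= A).

Section Regular.
Context {d : Order.disp_t} {L : orderType d}.
Context (hL : infinite_regular_cardinal L).
Local Notation small := (small L).

Lemma regular_wo : wochoice.well_order (<=%O : rel L).
Proof. by case: hL => -[]. Qed.

Lemma regular_inh : exists l : L, True.
Proof. by case: hL => _ /infinite_setN0[l _] _; exists l. Qed.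

Lemma small_card_le T U (A : set T) (B : set U) : A #<= B -> small B -> small A.
Proof. by move=> AB Bs LA; apply: Bs; apply: card_le_trans LA AB. Qed.

Lemma small_sub T (A B : set T) : A `<=` B -> small B -> small A.
Proof. by move=> AB; apply: small_card_le; apply: subset_card_le. Qed.

Lemma small_image T U (f : T -> U) (A : set T) : small A -> small (f @` A).
Proof. by apply: small_card_le; apply: card_image_le. Qed.

Lemma small_below (k : L) : small (below k).
Proof. by case: hL => -[_ /(_ k)/andP[_ /negP]]. Qed.

Lemma small_finite T (A : set T) : finite_set A -> small A.
Proof. by move=> fA LA; case: hL => _ + _; apply; apply: card_le_finite LA fA. Qed.

Lemma small_bounded (A : set L) : small A -> exists k, forall x, A x -> x < k.
Proof.
move=> As; apply: contrapT => nb; apply: As; case: hL => _ _ [_]; apply.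
split=> // x _; apply: contrapT => nx; apply: nb; exists x => a Aa.
by rewrite ltNge; apply/negP => xa; apply: nx; exists a.
Qed.

Lemma regular_gt (k : L) : exists k', k < k'.
Proof.
have [k' /(_ k erefl)] := small_bounded (small_finite (finite_set1 k)).
by exists k'.
Qed.

(** Given an injection [f] of [L] into the union, each [F i] contains only values of [f] at
    arguments below some [b i]; a bound [k] of all [b i] leaves no place for [f k]. *)
Lemma small_bigcup J T (D : set J) (F : J -> set T) :
  small D -> (forall i, D i -> small (F i)) -> small (\bigcup_(i in D) F i).
Proof.
move=> Ds Fs LF; have [x0] : exists x0 : T, True.
  have [l _] := regular_inh; apply: contrapT => nT.
  move: LF; rewrite (_ : \bigcup_(i in D) F i = set0) ?card_le0.
    by move=> /eqP/seteqP[/(_ l I)].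
  by rewrite -subset0 => z; case: nT; exists z.
move=> _; have [f [fF finj]] := card_le_funE x0 LF.
have /choice[b bP] : forall i, exists b, D i -> forall l, F i (f l) -> l < b.
  move=> i; have [Di|nDi] := pselect (D i); last first.
    by have [l _] := regular_inh; exists l.
  have [|k kP] := @small_bounded [set l | F i (f l)]; last by exists k.
  apply: small_card_le (Fs _ Di).
  by apply: (@card_le_fun _ _ _ _ f) => // l l' _ _; apply: finj.
have [k kP] := small_bounded (small_image (f := b) Ds).
have [i Di Fi] := fF k I.
have := lt_trans (bP _ Di _ Fi) (kP _ (ex_intro2 _ _ i Di erefl)).
by rewrite ltxx.
Qed.

Lemma small_setU T (A B : set T) : small A -> small B -> small (A `|` B).
Proof.
move=> As Bs; apply: (@small_sub _ _ (\bigcup_(b in [set: bool]) if b then A else B)).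
  by move=> x [Ax|Bx]; [exists true|exists false].
by apply: small_bigcup => [|[]//]; apply: small_finite; apply: finite_finset.
Qed.

End Regular.

(** * Cardinality and unboundedness in the successor cardinal *)

Section Successor.
Context {d d' : Order.disp_t} {L : orderType d} {K : orderType d'}.
Context (hL : infinite_regular_cardinal L) (hK : successor_cardinal L K).
Implicit Types (A B C S : set K).

Let l0 : L := sval (cid (regular_inh hL)).

Lemma succ_wo : wochoice.well_order (<=%O : rel K).
Proof. by case: hK. Qed.

Lemma below_card (x : K) : below x #<= [set: L].
Proof. by case: hK. Qed.

Lemma succ_not_le : ~ ([set: K] #<= [set: L]).
Proof. by case: hK => _ /andP[_ /negP]. Qed.

Lemma succ_inh : exists k : K, True.
Proof.
apply: contrapT => nK; apply: succ_not_le.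
rewrite (_ : [set: K] = set0) ?card_ge0 // -subset0 => k _.
by apply: nK; exists k.
Qed.

Let succ_point : K := sval (cid succ_inh).

Lemma regular_square : [set: L * L] #<= [set: L].
Proof.
apply: card_square; first exact: regular_wo; first by case: hL.
exact: small_below.
Qed.

Lemma succ_square : [set: K * K] #<= [set: K].
Proof.
apply: card_square; first exact: succ_wo.
  move=> fK; case: hL => _ + _; apply; apply: card_le_finite fK.
  by case: hK => _ /andP[].
by move=> x Kx; apply: succ_not_le; apply: card_le_trans Kx (below_card x).
Qed.

Lemma card_le_bigcup J T (D : set J) (F : J -> set T) : D #<= [set: L] ->
  (forall i, D i -> F i #<= [set: L]) -> \bigcup_(i in D) F i #<= [set: L].
Proof.
move=> DL FL; have [D0|/set0P[i0 Di0]] := eqVneq D set0.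
  by rewrite D0 bigcup_set0 card_ge0.
have [g [_ ginj]] := card_le_funE l0 DL.
have /choice[f fP] : forall i, exists f : T -> L, D i ->
    forall x y, F i x -> F i y -> f x = f y -> x = y.
  move=> i; have [Di|nDi] := pselect (D i); last by exists (fun=> l0).
  by have [f [_ finj]] := card_le_funE l0 (FL i Di); exists f.
have /choice[s sP] : forall x, exists i, (\bigcup_(i in D) F i) x -> D i /\ F i x.
  move=> x; have [[i Di Fi]|nx] := pselect ((\bigcup_(i in D) F i) x).
    by exists i.
  by exists i0.
apply: card_le_trans regular_square.
apply: (@card_le_fun _ _ _ _ (fun x => (g (s x), f (s x) x))) => // x y.
move=> /sP[Dx Fx] /sP[Dy Fy] [/ginj e1 e2].
by move: e2; rewrite -e1 // in Fy *; apply: fP.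
Qed.

(** Regularity of [K]: otherwise [K] would be a union of at most lambda segments of size at most
    lambda. *)
Lemma card_le_bounded A : A #<= [set: L] -> exists k, forall x, A x -> x < k.
Proof.
move=> AL; apply: contrapT => nb; apply: succ_not_le.
apply: (@card_le_trans _ _ _ (\bigcup_(a in A) (below a `|` [set a]))).
  apply: subset_card_le => x _; apply: contrapT => nx; apply: nb; exists x => a Aa.
  rewrite ltNge; apply/negP; rewrite le_eqVlt => /orP[/eqP xa|xa].
    by apply: nx; exists a => //; right.
  by apply: nx; exists a => //; left.
apply: card_le_bigcup => // a _; have [fin|inf] := pselect (finite_set (below a)).
  apply: (@card_le_trans _ _ _ [set: nat]).
    by apply: finite_set_countable; rewrite finite_setU; split=> //; apply: finite_set1.
  by apply/infiniteP; case: hL.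
exact: card_le_trans (infinite_card_setU1 _ inf) (below_card a).
Qed.

Lemma bounded_card_le A k : (forall x, A x -> x < k) -> A #<= [set: L].
Proof. by move=> Ak; apply: card_le_trans (below_card k); apply: subset_card_le. Qed.

Lemma succ_gt (k : K) : exists k', k < k'.
Proof.
have [|k' /(_ k erefl)] := @card_le_bounded [set k]; last by exists k'.
apply: (@card_le_trans _ _ _ [set: nat]).
  by apply: finite_set_countable; apply: finite_set1.
by apply/infiniteP; case: hL.
Qed.

Definition unbounded_in A : Prop := forall k, exists2 a, A a & k < a.

Lemma osup_unbounded A : osup A = [set: K] <-> unbounded_in A.
Proof.
split=> [e k|uA].
  by have [a Aa ka] : osup A k; [rewrite e|exists a].
by apply/seteqP; split=> // x _; have [a] := uA x; exists a.
Qed.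

Lemma unbounded_cofinal A : unbounded_in A -> cofinal_in [set: K] A.
Proof. by move=> uA; split=> // x _; have [a Aa /ltW] := uA x; exists a. Qed.

Lemma bounded_or_unbounded A :
  (exists k, forall x, A x -> x < k) \/ unbounded_in A.
Proof.
have [|nb] := pselect (exists k, forall x, A x -> x < k); [by left|right=> k].
apply: contrapT => nk; have [k' kk'] := succ_gt k; apply: nb; exists k' => x Ax.
apply: le_lt_trans kk'; rewrite leNgt; apply/negP => kx.
by apply: nk; exists x.
Qed.

Lemma unboundedP A : unbounded_in A <-> ~ (A #<= [set: L]).
Proof.
split=> [uA /card_le_bounded[k kP]|nA].
  by have [a /kP ak /(lt_trans ak)] := uA k; rewrite ltxx.
by have [[k /bounded_card_le]|] := bounded_or_unbounded A.
Qed.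

Lemma unbounded_card A : unbounded_in A -> [set: K] #<= A.
Proof.
move=> /unboundedP nA; apply: (wf_card_le (wo_wf succ_wo)) => [v w|w _ Aw].
  by case: (ltgtP v w); [right; left|right; right|left].
by apply: nA; apply: card_le_trans Aw _; apply: (@bounded_card_le _ w) => x [].
Qed.

Lemma unbounded_sub A B : A `<=` B -> unbounded_in A -> unbounded_in B.
Proof. by move=> AB uA k; have [a /AB] := uA k; exists a. Qed.

Lemma unbounded_pigeonhole T (F : K -> T) B : unbounded_in B ->
  F @` B #<= [set: L] -> exists t, unbounded_in [set b | B b /\ F b = t].
Proof.
move=> /unboundedP nB FB; apply: contrapT => nt; apply: nB.
apply: (@card_le_trans _ _ _ (\bigcup_(t in F @` B) [set b | B b /\ F b = t])).
  by apply: subset_card_le => b Bb; exists (F b) => //; exists b.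
apply: card_le_bigcup => // t _; apply: contrapT => /unboundedP ut.
by apply: nt; exists t.
Qed.

Lemma unbounded_gt A k : unbounded_in A -> unbounded_in [set a | A a /\ k < a].
Proof.
move=> uA k'; have [a Aa] := uA (Order.max k k').
by rewrite gt_max => /andP[ka k'a]; exists a.
Qed.

(** * Closure points and clubs *)

Lemma nat_card_le : [set: nat] #<= [set: L].
Proof. by apply/infiniteP; case: hL. Qed.

(** [a] is the supremum of the iterates of a function [h] that strictly dominates both the identity
    and [g]. *)
Lemma closure_point (g : K -> K) (x0 : K) :
  exists a, [/\ x0 < a, limit a & forall x, x < a -> g x < a].
Proof.
have /choice[h hP] : forall x, exists z, x < z /\ forall y, y <= x -> g y < z.
  move=> x; have [x' xx'] := succ_gt x.
  have [|k kP] := @card_le_bounded (g @` below x').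
    exact: card_le_trans (card_image_le _ _) (below_card x').
  exists (Order.max x' k); rewrite lt_max xx'; split=> // y yx.
  by rewrite lt_max kP ?orbT //; exists y => //; apply: le_lt_trans yx xx'.
have [|k kP] := @card_le_bounded (range (fun n => iter n h x0)).
  exact: card_le_trans (card_image_le _ _) nat_card_le.
have [|a [aP amin]] := wo_min succ_wo (P := fun a => forall n, iter n h x0 < a).
  by exists k => n; apply: kP; exists n.
have below_a y : y < a -> exists n, y <= iter n h x0.
  move=> ya; apply: contrapT => ny; have : a <= y.
    apply: amin => n; rewrite ltNge; apply/negP => yn; apply: ny; by exists n.
  by rewrite leNgt ya.
exists a; split; first exact: (aP 0%N).
  split=> [|y /below_a[n yn]]; first by exists x0; apply: (aP 0%N).
  by exists (iter n.+1 h x0) => //; apply: le_lt_trans yn _; case: (hP (iter n h x0)).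
move=> y /below_a[n yn]; apply: lt_trans (aP n.+1).
by case: (hP (iter n h x0)) => _; apply.
Qed.

Lemma limit_osup (a : K) A : (forall x, x < a -> exists2 y, A y & x < y /\ y < a) ->
  osup (A `&` below a) = below a.
Proof.
move=> Aa; apply/seteqP; split=> [x [y [_ ya] xy]|x /Aa[y Ay [xy ya]]].
  exact: lt_trans xy ya.
by exists y.
Qed.

Lemma osup_limit (a : K) A : osup (A `&` below a) = below a ->
  forall x, x < a -> exists2 y, A y & x < y /\ y < a.
Proof.
by move=> e x xa; have [y [Ay ya] xy] : osup (A `&` below a) x; [rewrite e|exists y].
Qed.

(** Between [x] and [nx x] every [C i] has a point, so a closure point of [nx] is a limit of each
    [C i]. *)
Lemma club_bigcap J (C : J -> set K) : [set: J] #<= [set: L] ->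
  (forall i, club (C i)) -> club [set a | forall i, C i a].
Proof.
move=> IL Cc; have /choice[nx nxP] : forall x, exists z, forall i,
    exists2 y, C i y & x < y /\ y < z.
  move=> x.
  have /choice[s sP] : forall i, exists y, C i y /\ x < y.
    by move=> i; case: (Cc i) => /osup_unbounded /(_ x)[y]; exists y.
  have [|k kP] := @card_le_bounded (range s).
    exact: card_le_trans (card_image_le _ _) IL.
  by exists k => i; case: (sP i) => ? ?; exists (s i) => //; split=> //; apply: kP; exists i.
split=> [|a la e i].
  apply/osup_unbounded => x0; have [a [x0a la ga]] := closure_point nx x0.
  exists a => // i; case: (Cc i) => _; apply=> //; apply: limit_osup => x xa.
  have [y Cy [xy yn]] := nxP x i; exists y => //; split=> //.
  exact: lt_trans yn (ga _ xa).
case: (Cc i) => _; apply=> //; apply: limit_osup => x xa.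
by have [y Cy ?] := osup_limit e xa; exists y.
Qed.

Lemma club_setI C C' : club C -> club C' -> club (C `&` C').
Proof.
move=> Cc Cc'.
rewrite (_ : (C `&` C')%classic = [set a | forall b : bool, (if b then C else C') a]).
  apply: (club_bigcap (C := fun b : bool => if b then C else C')) => [|[]//].
  apply: card_le_trans nat_card_le.
  by apply: finite_set_countable; apply: finite_finset.
by apply/seteqP; split=> [x [? ?] []//|x xP]; split; [apply: (xP true)|apply: (xP false)].
Qed.

Lemma club_closed_under (g : K -> K) : club [set a | forall x, x < a -> g x < a].
Proof.
split=> [|a la e x xa].
  by apply/osup_unbounded => x0; have [a [x0a _ ga]] := closure_point g x0; exists a.
have [y yP [xy ya]] := osup_limit e xa.
exact: lt_trans (yP _ xy) ya.
Qed.

Lemma club_gt (k : K) : club [set a | k < a].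
Proof.
split=> [|a la e].
  apply/osup_unbounded => x.
  by have [a [xa _ /(_ x xa)]] := closure_point (fun=> k) x; exists a.
have [[x xa] _] := la; have [y /= ky [_ ya]] := osup_limit e xa.
exact: lt_trans ky ya.
Qed.

(** * Stationary sets: pressing down and splitting *)

Lemma stationary_gt S k : stationary S -> stationary [set a | S a /\ k < a].
Proof.
move=> Ss C Cc; have [a [Sa [ka Ca]]] := Ss _ (club_setI (club_gt k) Cc).
by exists a.
Qed.

Lemma stationary_bigcup S (F : L -> set K) : stationary S ->
  (forall a, S a -> exists i, F i a) -> exists i, stationary (F i).
Proof.
move=> Ss SF; apply: contrapT => nst.
have /choice[C CP] : forall i, exists C, club C /\ forall a, F i a -> ~ C a.
  move=> i; apply: contrapT => nC; apply: nst; exists i => C Cc.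
  apply: contrapT => FC; apply: nC; exists C; split=> // a Fa Ca.
  by apply: FC; exists a.
have Cc i : club (C i) by case: (CP i).
have [a [Sa Ca]] := Ss _ (club_bigcap (card_lexx _) Cc).
by have [i Fi] := SF a Sa; case: (CP i) => _ /(_ a Fi); apply; apply: Ca.
Qed.

(** A weak form of Fodor's lemma. If each such set were bounded by [g k], a point [a] of [S] and [C]
    closed under [g] would satisfy [a < g (f a) < a]. *)
Lemma regressive_unbounded S C (f : K -> K) : stationary S -> club C ->
  (forall a, S a -> C a -> f a < a) ->
  exists k, unbounded_in [set a | [/\ S a, C a & f a <= k]].
Proof.
move=> Ss Cc fl; apply: contrapT => nk.
have /choice[g gP] : forall k, exists b, forall a, S a -> C a -> f a <= k -> a < b.
  move=> k.
  have [[b bP]|ub] := bounded_or_unbounded [set a | [/\ S a, C a & f a <= k]].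
    by exists b => a ? ? ?; apply: bP.
  by case: nk; exists k.
have [a [Sa [Ca ga]]] := Ss _ (club_setI Cc (club_closed_under g)).
have := lt_trans (gP _ _ Sa Ca (lexx _)) (ga _ (fl _ Sa Ca)).
by rewrite ltxx.
Qed.

Lemma below_injections : exists e : K -> K -> L, forall a x y,
  x < a -> y < a -> e a x = e a y -> x = y.
Proof.
have /choice[e eP] : forall a, exists f : K -> L, forall x y,
    x < a -> y < a -> f x = f y -> x = y.
  by move=> a; have [f [_ finj]] := card_le_funE l0 (below_card a); exists f.
by exists e.
Qed.

(* Ulam matrix *)
Lemma stationary_split S : stationary S ->
  exists phi : K -> K, forall p, stationary [set a | S a /\ phi a = p].
Proof.
move=> Ss; have [e einj] := below_injections.
have /choice[nu nuP] : forall x, exists n,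
    stationary [set a | [/\ S a, x < a & e a x = n]].
  move=> x; apply: (stationary_bigcup (stationary_gt x Ss)) => a [Sa xa].
  by exists (e a x).
have [||n uX] := @unbounded_pigeonhole _ nu setT.
- by move=> k; have [k' kk'] := succ_gt k; exists k'.
- exact: card_leT.
have [g [gX ginj]] := card_le_funE succ_point (unbounded_card uX).
(* Injectivity of [e a] leaves at most one [g p] below [a] with value [n], and [phi a] reads off its
   index. *)
have /choice[phi phiP] : forall a, exists q, forall p,
    g p < a -> e a (g p) = n -> q = p.
  move=> a; have [[p [pa ep]]|np] := pselect (exists p, g p < a /\ e a (g p) = n).
    exists p => q qa eq; apply: ginj => //; apply: (einj a) => //; by rewrite ep eq.
  by exists succ_point => p pa ep; case: np; exists p.
exists phi => p C Cc; have [_ np] := gX p I.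
have [a [[Sa pa ep] Ca]] := nuP (g p) C Cc; exists a; split=> //; split=> //.
by apply: phiP => //; rewrite ep np.
Qed.

End Successor.

(** * Enumerations and points of cofinality lambda *)

Lemma card_le_surjE T U (u0 : U) (A : set T) (B : set U) :
  A #<= B -> A !=set0 ->
  exists g : U -> T, (forall u, A (g u)) /\ forall x, A x -> exists u, g u = x.
Proof.
move=> /(card_le_funE u0)[f [_ finj]] [a0 Aa0].
have /choice[g gP] : forall u, exists x, A x /\ forall z, A z -> f z = u -> x = z.
  move=> u; have [[x [Ax fx]]|nx] := pselect (exists x, A x /\ f x = u).
    by exists x; split=> // z Az fz; apply: finj => //; rewrite fx.
  by exists a0; split=> // z Az fz; case: nx; exists z.
exists g; split=> [u|x Ax]; first by case: (gP u).
by exists (f x); case: (gP (f x)) => _; apply.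
Qed.

Section Cofinality.
Context {d d' : Order.disp_t} {L : orderType d} {K : orderType d'}.
Context (hL : infinite_regular_cardinal L).
Implicit Types (a : K) (A : set K).

Lemma Ecf_bounded a A : Ecf L K a -> small L A -> (forall b, A b -> b < a) ->
  exists2 x, x < a & forall b, A b -> b < x.
Proof.
move=> [_ cfa] As Aa; apply: contrapT => nx; apply: As; apply: cfa.
split=> // x xa; apply: contrapT => nb; apply: nx; exists x => // b Ab.
by rewrite ltNge; apply/negP => xb; apply: nb; exists b.
Qed.

Lemma Ecf_limit a : Ecf L K a -> limit a.
Proof.
move=> ha; split.
  have [|//|x xa _] := @Ecf_bounded a set0 ha _ _; last by exists x.
  exact: small_finite.
move=> x xa; have [|b /= ->//|y ya yP] := @Ecf_bounded a [set x] ha _ _.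
  exact: small_finite.
by exists y => //; apply: yP.
Qed.

Lemma Ecf_enum a : Ecf L K a ->
  exists f : L -> K, (forall j, f j < a) /\ forall x, x < a -> exists j, x <= f j.
Proof.
move=> [[A [Aa Acof] /card_eqPle[AL LA]] _]; have [l _] := regular_inh hL.
have [|f [fA fsurj]] := card_le_surjE l AL.
  apply/set0P/eqP => A0; move: LA; rewrite A0 card_le0 => /eqP/seteqP[].
  by move=> /(_ l I).
exists f; split=> [j|x xa]; first exact/Aa/fA.
by have [b Ab xb] := Acof x xa; have [j fj] := fsurj _ Ab; exists j; rewrite fj.
Qed.

End Cofinality.

(** * Initial segments of the functions [c_b] *)

Section Coloring.
Context {d d' : Order.disp_t} {L : orderType d} {K : orderType d'}.
Context (hL : infinite_regular_cardinal L) (hK : successor_cardinal L K).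
Context (c : L -> K -> L).
Implicit Types (a b x : K) (eta : L) (B S : set K).

Let l0 : L := sval (cid (regular_inh hL)).
Let k0 : K := sval (cid (succ_inh hK)).
Local Notation small := (small L).

Definition agree eta b x : Prop := forall z, z < eta -> c z b = c z x.

Lemma crestr_agree eta b x : crestr c b eta = crestr c x eta <-> agree eta b x.
Proof.
split=> [e z ze|bx]; last by apply/funext => -[z ze]; apply: bx.
by have := congr1 (fun f => f (exist _ z ze)) e.
Qed.

Lemma agree_sym eta b x : agree eta b x -> agree eta x b.
Proof. by move=> bx z ze; rewrite bx. Qed.

Lemma agree_trans eta b x b' : agree eta b x -> agree eta x b' -> agree eta b b'.
Proof. by move=> bx xb z ze; rewrite bx ?xb. Qed.

Section StronglyUnbounded.
Context (suc : strongly_unbounded c).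

(** Strong unboundedness with the node [t] replaced by a member [b0] of [B] lying on it. *)
Lemma unbounded_branching B : unbounded_in B ->
  exists eta b0, B b0 /\ forall k, exists b, [/\ B b, agree eta b b0 & k < c eta b].
Proof.
move=> /unbounded_cofinal/suc[eta [t e]].
have val k : exists b, [/\ B b, crestr c b eta = t & k < c eta b].
  have [_ [b [Bb bt] <-] kb] :
      osup [set c eta b | b in [set b | B b /\ crestr c b eta = t]] k.
    by rewrite e.
  by exists b.
have [b0 [Bb0 b0t _]] := val l0; exists eta, b0; split=> // k.
by have [b [Bb bt kb]] := val k; exists b; split=> //; apply/crestr_agree; rewrite bt.
Qed.

(** On an unbounded fiber some coordinate would take unboundedly many values, yet each coordinate is
    constant. *)
Lemma fiber_card_le (y : L -> L) : [set b | forall z, c z b = y z] #<= [set: L].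
Proof.
apply: contrapT => /(unboundedP hL hK)/unbounded_branching[eta [b0 [b0y br]]].
by have [b [/= -> _]] := br (y eta); rewrite ltxx.
Qed.

(* Otherwise there are unboundedly many [b] with pairwise distinct [c_b|eta],
   which may moreover be assumed to be bounded by a fixed ordinal: then no
   node of the tree they generate is unboundedly branching. *)
Lemma level_card_le eta :
  exists2 R : set K, R #<= [set: L] & forall b, exists2 x, R x & agree eta x b.
Proof.
(* [f b] is the least representative of [b] modulo agreement below [eta]. *)
have /choice[f fP] : forall b, exists x,
    agree eta x b /\ forall x', agree eta x' b -> x <= x'.
  by move=> b; apply: (wo_min (succ_wo hK)); exists b.
exists (range f); last by move=> b; exists (f b); [exists b|case: (fP b)].
apply: contrapT => /(unboundedP hL hK) uR.
have finj b b' : agree eta (f b) (f b') -> f b = f b'.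
  move=> bb'; apply/eqP; rewrite eq_le; apply/andP; split.
    apply: (fP b).2; apply: agree_trans (fP b).1.
    by apply: agree_sym.
  by apply: (fP b').2; apply: agree_trans (fP b').1.
have /choice[bd bdP] : forall b, exists m, forall z, z < eta -> c z b < m.
  move=> b; have [|m mP] := small_bounded hL (A := (fun z => c z b) @` below eta).
    by apply: small_image; apply: small_below.
  by exists m => z ze; apply: mP; exists z.
have [|m uR'] := unbounded_pigeonhole hL hK (F := bd) uR; first exact: card_leT.
have [eta' [_ [[[u0 _ <-] _] br]]] := unbounded_branching uR'.
(* A node of height at least [eta] determines its representative, so it cannot branch; at a node of
   smaller height the values stay below [m]. *)
have [ee'|e'e] := leP eta eta'.
  have [_ [[[u _ <-] _] /= ag]] := br (c eta' (f u0)).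
  rewrite (finj u u0) ?ltxx // => z ze; apply: ag; exact: lt_le_trans ze ee'.
have [b [[_ bm] _]] := br m; rewrite ltNge; move/negP; apply; apply: ltW.
by rewrite -bm; apply: bdP.
Qed.

Lemma nodes_enum : exists r : L -> K, forall b eta, exists m, agree eta (r m) b.
Proof.
have /choice[R RP] : forall eta, exists R : set K, R #<= [set: L] /\
    forall b, exists2 x, R x & agree eta x b.
  by move=> eta; have [R ? ?] := level_card_le eta; exists R.
have : \bigcup_eta R eta #<= [set: L].
  by apply: card_le_bigcup => // eta _; case: (RP eta).
move=> /(card_le_surjE l0)[|r [_ rsurj]].
  by case: (RP l0) => _ /(_ k0)[x Rx _]; exists x, l0.
exists r => b eta; case: (RP eta) => _ /(_ b)[x Rx xb].
by have [|m rm] := rsurj x; [exists eta|exists m; rewrite rm].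
Qed.

End StronglyUnbounded.

(** * Trees supplied by tightness *)

Lemma tight_enum : tight c -> exists Tr : K -> set lseqs,
  (forall i, Tfam c (Tr i)) /\ forall T, Tfam c T -> exists i, Tr i `<=` T.
Proof.
move=> [DD [DDT DDK DDd]].
have [|Tr [TrD Trs]] := card_le_surjE k0 DDK.
  (* The full tree has unboundedly many branches, so the dense family is nonempty. *)
  have [|D DDD _] := DDd setT; last by exists D.
  apply/osup_unbounded => k; have [k' kk'] := succ_gt hL hK k.
  by exists k'.
exists Tr; split=> [i|T /DDd[D /Trs[i <-]]]; first exact/DDT.
by exists i.
Qed.

Definition dense_in B (T : set lseqs) : Prop := forall b eta,
  branches c T b -> unbounded_in [set b' | B b' /\ agree eta b' b].

(** Let [g] bound [B] on every node that [B] meets boundedly. The tree generated by the part of [B]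
    above [g] contains some [Tr i], and its nodes, being met above [g], are met unboundedly. *)
Lemma tight_dense (r : L -> K) (Tr : K -> set lseqs) B :
  (forall b eta, exists m, agree eta (r m) b) ->
  (forall T, Tfam c T -> exists i, Tr i `<=` T) ->
  unbounded_in B -> exists i, dense_in B (Tr i).
Proof.
move=> rP TrP uB; pose N (p : L * L) := [set b | B b /\ agree p.2 b (r p.1)].
have /choice[bd bdP] : forall p, exists k,
    (forall b, N p b -> b < k) \/ unbounded_in (N p).
  by move=> p; have [[k kP]|u] := bounded_or_unbounded hL hK (N p);
    [exists k; left|exists k0; right].
have [|g gP] := card_le_bounded hL hK (A := range bd).
  exact: card_le_trans (card_image_le _ _) (regular_square hL).
have [|i Ti] := TrP [set s | exists2 b, B b /\ g < b &
                                projT2 s = crestr c b (projT1 s)].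
  apply/osup_unbounded; apply: unbounded_sub (unbounded_gt g uB).
  by move=> b Bb eta; exists b.
exists i => b eta /(_ eta)/Ti[b' [Bb' gb'] /= /crestr_agree bb'].
have [m rm] := rP b eta.
have Nb' : N (m, eta) b'.
  by split=> //; apply: agree_trans (agree_sym rm); apply: agree_sym.
have [/(_ b' Nb') lt|] := bdP (m, eta).
  have := lt_trans (lt_trans lt (gP _ (ex_intro2 _ _ (m, eta) I erefl))) gb'.
  by rewrite ltxx.
by apply: unbounded_sub => x [Bx xr]; split=> //; apply: agree_trans xr rm.
Qed.

(** * Sets attached to a branch, and ladders *)

Section Guessing.
Context (e : K -> K -> L).
Context (einj : forall a x y, x < a -> y < a -> e a x = e a y -> x = y).

Lemma e_small a n : small [set b | b < a /\ e a b <= n].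
Proof.
have [n' nn'] := regular_gt hL n.
apply: small_card_le (small_below hL (k := n')).
apply: (@card_le_fun _ _ _ _ (e a)) => [b [_ bn]|b b' [ba _] [ba' _]].
  exact: le_lt_trans bn nn'.
exact: einj.
Qed.

(* The relation [min_(b < x < a) max (e x b) (e a x) <= n]: like [e a b <= n]
   it has small sections, and it is bounded by [max (e x b) (e a x)], whose
   second argument is independent of [b]. *)
Definition near a n b : Prop := exists x, [/\ b < x, x < a, e x b <= n & e a x <= n].

Lemma near_small a n : small [set b | near a n b].
Proof.
apply: (@small_sub _ _ _ _ (\bigcup_(x in [set x | x < a /\ e a x <= n])
    [set b | b < x /\ e x b <= n])).
  by move=> b [x [bx xa ? ?]]; exists x.
by apply: small_bigcup => // [|x _]; apply: e_small.
Qed.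

Lemma near_lt a n b : near a n b -> b < a.
Proof. by move=> [x [bx xa _ _]]; apply: lt_trans bx xa. Qed.

(* [eta] is the first difference of [c_b] and [c_x]. *)
Definition split_near a x : set K :=
  [set b | exists eta, [/\ agree eta b x, c eta b <> c eta x & near a (c eta x) b]].

Lemma small_near_below a x eta0 :
  small [set b | exists2 eta, eta < eta0 & near a (c eta x) b].
Proof.
apply: (@small_sub _ _ _ _ (\bigcup_(eta in below eta0) [set b | near a (c eta x) b])).
  by move=> b [eta ? ?]; exists eta.
by apply: small_bigcup => // [|eta _]; [apply: small_below|apply: near_small].
Qed.

Lemma split_near_ad a a' x x' : ~ (forall z, c z x = c z x') ->
  small (split_near a x `&` split_near a' x').
Proof.
(* [z'] exceeds [z] so that a split at [z] itself is counted. *)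
move=> /existsNP[z zx]; have [z' zz'] := regular_gt hL z.
apply: small_sub (small_setU hL (small_near_below (a := a) (x := x) (eta0 := z'))
  (small_near_below (a := a') (x := x') (eta0 := z'))).
move=> b [[eta [bx _ nb]] [eta' [bx' _ nb']]].
have [ze|ez] := ltP z eta; last by left; exists eta => //; apply: le_lt_trans ez zz'.
have [ze'|ez'] := ltP z eta'; last by right; exists eta' => //; apply: le_lt_trans ez' zz'.
by case: zx; rewrite -bx // bx'.
Qed.

(* If the functions [c_b], [b < a], accumulate at a function [y] along [a], then
   a ladder converging to [y] is almost disjoint from [split_near a' x] unless
   [c_x = y]; if they do not accumulate, any ladder will do. *)
Lemma ladder a : Ecf L K a -> exists (q : L -> L -> K) (y : L -> L),
  [/\ forall k j k' j', q k j = q k' j' -> k = k' /\ j = j',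
      forall k j, q k j < a,
      forall x, x < a -> small [set b | b < x /\ exists k j, b = q k j] &
      forall x, ~ (forall z, c z x = y z) -> exists eta,
        small [set b | agree eta b x /\ exists k j, b = q k j]].
Proof.
move=> ha; have [f [fa fcof]] := Ecf_enum hL ha.
(* [f] need not be monotone; [g j] lies above all earlier [f j'], so a sequence above [g] eventually
   leaves each proper segment of [a]. *)
have /choice[g gP] : forall j, exists x, x < a /\ forall j', j' <= j -> f j' < x.
  move=> j; have [j1 jj1] := regular_gt hL j.
  have [||x xa xP] := Ecf_bounded ha (A := f @` below j1).
  - exact/small_image/small_below.
  - by move=> _ [i _ <-].
  exists x; split=> // j' j'j; apply: xP; exists j' => //.
  exact: le_lt_trans j'j jj1.
have tail (s : L -> K) x : (forall j, g j <= s j) -> x < a ->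
    exists j0, forall j, s j < x -> j < j0.
  move=> gs /fcof[j0 xj0]; exists j0 => j sx; rewrite ltNge; apply/negP => j0j.
  have := lt_le_trans ((gP j).2 _ j0j) (le_trans (gs j) (ltW sx)).
  by rewrite ltNge xj0.
have [s [y [gs sa sy]]] : exists (s : L -> K) (y : L -> L),
   [/\ forall j, g j <= s j, forall j, s j < a &
    forall x, ~ (forall z, c z x = y z) -> exists eta j1,
      forall j, agree eta (s j) x -> j < j1].
  have [[y yP]|ny] := pselect (exists y : L -> L, forall eta x, x < a ->
      exists b, [/\ x <= b, b < a & forall z, z < eta -> c z b = y z]).
    have /choice[s sP] : forall j, exists b,
        [/\ g j <= b, b < a & forall z, z < j -> c z b = y z].
      by move=> j; apply: yP; case: (gP j).
    exists s, y; split=> [j|j|x]; [by case: (sP j)|by case: (sP j)|].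
    move=> /existsNP[z zx]; have [eta ze] := regular_gt hL z; exists eta, eta => j ag.
    rewrite ltNge; apply/negP => ej; case: zx; rewrite -ag //.
    by case: (sP j) => _ _; apply; apply: lt_le_trans ze ej.
  (* Without accumulation, each [c_x] has an initial segment shared by no [b] in a tail of [a]; the
     value of [y] is arbitrary. *)
  exists g, (fun=> l0); split=> [//|j|x _]; first by case: (gP j).
  have [eta [g0 [g0a nb]]] : exists eta g0, g0 < a /\
      forall b, g0 <= b -> b < a -> ~ agree eta b x.
    apply: contrapT => nn; apply: ny; exists (c^~ x) => eta g0 g0a.
    apply: contrapT => nb; apply: nn; exists eta, g0; split=> // b g0b ba ag.
    by apply: nb; exists b.
  have [j1 j1P] := tail g g0 (fun=> lexx _) g0a; exists eta, j1 => j ag.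
  apply: j1P; rewrite ltNge; apply/negP => /nb; apply=> //; by case: (gP j).
have sns : ~ small (range s).
  move=> /(Ecf_bounded ha)[|x xa xP]; first by move=> _ [j _ <-].
  have [j0 j0P] := tail s x gs xa.
  by have := j0P j0 (xP _ (ex_intro2 _ _ j0 I erefl)); rewrite ltxx.
(* [range s] is unbounded in [a], hence of size lambda, and can be cut into lambda disjoint
   ladders. *)
have /(card_le_funE k0)[q [qs qinj]] : [set: L * L] #<= range s.
  by apply: card_le_trans (regular_square hL) _; apply: contrapT.
exists (fun k j => q (k, j)), y; split.
- by move=> k j k' j' /qinj -/(_ I I) [-> ->].
- by move=> k j; have [i _ <-] := qs (k, j) I.
- move=> x xa; have [j0 j0P] := tail s x gs xa.
  apply: small_sub (small_image (f := s) (small_below hL (k := j0))).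
  move=> b [bx [k [j bq]]]; have [i _ si] := qs (k, j) I; exists i.
    by apply: j0P; rewrite si -bq.
  by rewrite si bq.
- move=> x /sy[eta [j1 j1P]]; exists eta.
  apply: small_sub (small_image (f := s) (small_below hL (k := j1))).
  move=> b [bx [k [j bq]]]; have [i _ si] := qs (k, j) I; exists i.
    by apply: j1P; rewrite si -bq.
  by rewrite si bq.
Qed.

End Guessing.
End Coloring.

(** * Choice of the branches and the guessing argument *)

Section Family.
Context {d d' : Order.disp_t} {L : orderType d} {K : orderType d'}.
Context (hL : infinite_regular_cardinal L) (hK : successor_cardinal L K).
Context (c : L -> K -> L) (suc : strongly_unbounded c).
Context (Tr : K -> set (@lseqs _ L)) (TrT : forall i, Tfam c (Tr i)).
Local Notation small := (small L).

(** Recursion over triples coded in [K]: each stage forbids at most lambda functions, each equal to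
    [c_x] for at most lambda many [x], while [Tr i] has unboundedly many branches. *)
Lemma branches_choice (y : K -> L -> L) : exists x : K -> L -> K -> K,
  [/\ forall a k i, branches c (Tr i) (x a k i),
      forall a k i, a <= x a k i,
      forall a k i a', a' <= a -> ~ (forall z, c z (x a k i) = y a' z) &
      forall a k i a' k' i', (a, k, i) <> (a', k', i') ->
        ~ (forall z, c z (x a k i) = c z (x a' k' i'))].
Proof.
have [x0 _] := succ_inh hK.
have LK : [set: L] #<= [set: K] by case: hK => _ /andP[].
have XT T U : [set: T * U] = [set: T] `*` [set: U] by apply/seteqP; split.
have /(card_le_funE x0)[code [_ cinj]] : [set: K * L * K] #<= [set: K].
  apply: card_le_trans (succ_square hL hK); rewrite !XT.
  apply: card_leX => //; apply: card_le_trans (succ_square hL hK); rewrite XT.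
  exact: card_leX.
pose same (f g : L -> L) := forall z, f z = g z.
have [||x xP] := @greedy_choice (K * L * K) K (fun v w => code v < code w) setT
  (fun w x => [/\ branches c (Tr w.2) x, w.1.1 <= x &
     forall a, a <= w.1.1 -> ~ same (c^~ x) (y a)])
  (fun x x' => ~ same (c^~ x) (c^~ x')) x0.
- exact: wf_inverse_image (wo_wf (succ_wo hK)).
(* [a1] exceeds [a], so that [y a] itself is forbidden. *)
- move=> [[a k] i] f _ /=; have [a1 aa1] := succ_gt hL hK a.
  pose bad := (\bigcup_(v in [set v | code v < code (a, k, i)])
                 [set x | same (c^~ x) (c^~ (f v))]) `|`
              (\bigcup_(a' in below a1) [set x | same (c^~ x) (y a')]).
  have [|m mP] := card_le_bounded hL hK (A := bad).
    have -> : bad = \bigcup_(b in [set: bool]) if b then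
        \bigcup_(v in [set v | code v < code (a, k, i)])
          [set x | same (c^~ x) (c^~ (f v))]
        else \bigcup_(a' in below a1) [set x | same (c^~ x) (y a')].
      apply/seteqP; split=> [z [?|?]|z [[] _ ?]];
        [by exists true|by exists false|by left|by right].
    apply: (card_le_bigcup hL) => [|[] _].
    + apply: card_le_trans (nat_card_le hL).
      by apply: finite_set_countable; apply: finite_finset.
    + apply: (card_le_bigcup hL) => [|v _]; last exact: fiber_card_le.
      apply: card_le_trans (below_card hK (code (a, k, i))).
      by apply: (@card_le_fun _ _ _ _ code) => // v w _ _; apply: cinj.
    + apply: (card_le_bigcup hL) => [|a' _]; last exact: fiber_card_le.
      exact: below_card.
  have /osup_unbounded/(_ (Order.max m a))[x bx] := TrT i.
  rewrite gt_max => /andP[mx ax].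
  have nbad : ~ bad x by move=> /mP /(lt_trans mx); rewrite ltxx.
  exists x; split; [split=> //; first exact: ltW|].
    move=> a' a'a sm; apply: nbad; right; exists a' => //.
    exact: le_lt_trans a'a aa1.
  move=> v _ vw sm; apply: nbad; left; exists v => // z; by rewrite sm.
have xI w : [/\ branches c (Tr w.2) (x w), w.1.1 <= x w &
     forall a, a <= w.1.1 -> ~ same (c^~ (x w)) (y a)] by case: (xP w I).
exists (fun a k i => x (a, k, i)); split.
- by move=> a k i; case: (xI (a, k, i)).
- by move=> a k i; case: (xI (a, k, i)).
- by move=> a k i a' aa'; case: (xI (a, k, i)) => _ _; apply.
move=> a k i a' k' i'; set v := (a, k, i); set w := (a', k', i') => vw sm.
have [lt|lt|/cinj e] := ltgtP (code v) (code w); last exact/vw/e.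
- by case: (xP w I) => _ /(_ v I lt); apply.
- by case: (xP v I) => _ /(_ w I lt); apply=> z; rewrite sm.
Qed.

Context (e : K -> K -> L).
Context (einj : forall a x y, x < a -> y < a -> e a x = e a y -> x = y).
Context (x : K -> L -> K -> K) (G : K -> set K) (Gs : forall a, small (G a)).
Context (xb : forall a k i, branches c (Tr i) (x a k i)).
Context (xge : forall a k i, a <= x a k i).

(** [G a] lists the fewer than lambda trees treated at [a]; [k] numbers the lambda sets to be
    attached to [a]. *)
Definition guess a k : set K := \bigcup_(i in G a) split_near c e a (x a k i).

Lemma guess_lt a k b : guess a k b -> b < a.
Proof. by move=> [i _ [eta [_ _ /near_lt]]]. Qed.

Lemma guess_unbounded (S C : set K) (BB : set (set K)) :
  stationary S -> club C -> BB #<= [set: L] ->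
  (forall B, BB B -> exists i, dense_in c B (Tr i) /\ forall a, S a -> G a i) ->
  exists a, [/\ S a, C a & forall k B, BB B -> forall g, g < a ->
    exists b, [/\ guess a k b, B b & g < b]].
Proof.
move=> Ss Cc BBL BBi; apply: contrapT => na.
have [k0 _] := succ_inh hK; have [l0 _] := regular_inh hL.
(* [f a] records a failing pair [(k, B)] and a bound below [a] for [B] on [guess a k]. *)
have /choice[f fP] : forall a, exists p : (L * set K) * K, S a -> C a ->
    [/\ BB p.1.2, p.2 < a & forall b, guess a p.1.1 b -> p.1.2 b -> b <= p.2].
  move=> a; apply: contrapT => np; apply: na; exists a; split.
  - by apply: contrapT => nS; apply: np; exists (l0, set0, k0).
  - by apply: contrapT => nC; apply: np; exists (l0, set0, k0).
  move=> k B BBB g ga; apply: contrapT => nb; apply: np; exists (k, B, g) => _ _.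
  split=> // b gb /= Bb; rewrite leNgt; apply/negP => gtb.
  by apply: nb; exists b.
have [|g uS1] := regressive_unbounded hL hK (f := fun a => (f a).2) Ss Cc.
  by move=> a Sa Ca; case: (fP a Sa Ca).
have [|[k B] uS2] := unbounded_pigeonhole hL hK (F := fun a => (f a).1) uS1.
  apply: (@card_le_trans _ _ _ ([set: L] `*` BB)).
    by apply: subset_card_le => _ [a [Sa Ca _] <-]; split=> //; case: (fP a Sa Ca).
  apply: card_le_trans (card_leX (card_lexx _) BBL) _.
  by apply: card_le_trans (regular_square hL); apply: subset_card_le.
have {uS2}[S2 uS2 S2P] : exists2 S2, unbounded_in S2 & forall a, S2 a ->
    [/\ S a, BB B & forall b, guess a k b -> B b -> b <= g].
  eexists; first exact: uS2.
  move=> a [[Sa Ca fg] fkB]; case: (fP a Sa Ca); rewrite fkB => BBB _ gB.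
  by split=> // b gb Bb; apply: le_trans (gB _ gb Bb) fg.
have [a2 /S2P[_ BBB _] _] := uS2 k0; have [i [Bi GSi]] := BBi B BBB.
have [r rP] := nodes_enum hL hK suc.
(* For each node met unboundedly by [B], [bt] picks a point of [B] on it above [g]; [dl] then bounds
   all these points. *)
have /choice[bt btP] : forall p : L * L, exists b,
    unbounded_in [set b | B b /\ agree c p.2 b (r p.1)] ->
    [/\ B b, agree c p.2 b (r p.1) & g < b].
  move=> p; have [u|nu] := pselect (unbounded_in [set b | B b /\ agree c p.2 b (r p.1)]).
    by have [b [Bb bp] gb] := u g; exists b.
  by exists k0.
have [|dl dlP] := card_le_bounded hL hK (A := range bt).
  exact: card_le_trans (card_image_le _ _) (regular_square hL).
(* With [e a dl] fixed, [dl] can be the intermediate point in [near], with bounds independent of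
   [a]. *)
have [|nu uS4] := unbounded_pigeonhole hL hK (F := fun a => e a dl) (unbounded_gt dl uS2).
  exact: card_leT.
have uX : unbounded_in [set x a k i | a in [set b | [/\ S2 b, dl < b & e b dl = nu]]].
  move=> m; have [a [[S2a dla] ea] ma] := uS4 m; exists (x a k i); first by exists a.
  exact: lt_le_trans ma (xge _ _ _).
have [eta [_ [[a0 _ <-] br]]] := unbounded_branching hL suc uX.
have [m rm] := rP (x a0 k i) eta.
have [|Bb br' gb] := btP (m, eta).
  apply: unbounded_sub (Bi _ eta (xb a0 k i)) => b [Bb bx]; split=> //.
  exact: agree_trans bx (agree_sym rm).
set b := bt (m, eta) in Bb br' gb.
have bdl : b < dl by apply: dlP; exists (m, eta).
(* Exceeding [c eta b] makes [eta] the first difference; exceeding [e dl b] and [nu] makes [b] near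
   [a] through [dl]. *)
have [_ [[a [S2a dla ea] <-] ax]] := br (Order.max (c eta b) (Order.max (e dl b) nu)).
rewrite !gt_max => /and3P[cb eb nub].
suff gab : guess a k b.
  by have [_ _ /(_ b gab Bb)] := S2P a S2a; rewrite leNgt gb.
have [Sa _ _] := S2P a S2a.
exists i; first exact: GSi.
exists eta; split.
- exact: agree_trans br' (agree_trans rm (agree_sym ax)).
- by move=> eq; rewrite eq ltxx in cb.
by exists dl; split=> //; [apply: ltW|rewrite ea; apply: ltW].
Qed.

(** * The almost disjoint family *)

Context (y : K -> L -> L) (q : K -> L -> L -> K).
Context (xy : forall a k i a', a' <= a -> ~ (forall z, c z (x a k i) = y a' z)).
Context (xx : forall a k i a' k' i', (a, k, i) <> (a', k', i') ->
  ~ (forall z, c z (x a k i) = c z (x a' k' i'))).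
Context (qinj : forall a, Ecf L K a -> forall k j k' j',
  q a k j = q a k' j' -> k = k' /\ j = j').
Context (qlt : forall a, Ecf L K a -> forall k j, q a k j < a).
Context (qsmall : forall a, Ecf L K a -> forall g, g < a ->
  small [set b | b < g /\ exists k j, b = q a k j]).
Context (qy : forall a, Ecf L K a -> forall x', ~ (forall z, c z x' = y a z) ->
  exists eta, small [set b | agree c eta b x' /\ exists k j, b = q a k j]).

Definition pre_family a k : set K := guess a k `|` range (q a k).

(** Subtracting the earlier sets turns almost disjointness at one [a] into disjointness. *)
Definition family a k : set K :=
  pre_family a k `\` \bigcup_(l in below k) pre_family a l.

Lemma pre_family_lt a k b : Ecf L K a -> pre_family a k b -> b < a.
Proof. by move=> ha [/guess_lt//|[j _ <-]]; apply: qlt. Qed.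

Lemma guess_ad a k a' k' : (a, k) <> (a', k') ->
  small (guess a k `&` guess a' k').
Proof.
move=> ne; apply: (@small_sub _ _ _ _ (\bigcup_(i in G a) \bigcup_(i' in G a')
    (split_near c e a (x a k i) `&` split_near c e a' (x a' k' i')))).
  by move=> b [[i Gi bi] [i' Gi' bi']]; exists i => //; exists i'.
apply: (small_bigcup hL) => [|i _]; first exact: Gs.
apply: (small_bigcup hL) => [|i' _]; first exact: Gs.
apply: split_near_ad => //.
by refine (xx _) => -[ea ek _]; apply: ne; rewrite ea ek.
Qed.

(** If [a < a'], the ladder has few points below [a]. Otherwise [c_x] differs from [y a']: few
    ladder points follow [c_x] up to some [eta], and few points of the guess split earlier. *)
Lemma guess_ladder_ad a k a' k' : Ecf L K a' ->
  small (guess a k `&` range (q a' k')).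
Proof.
move=> ha'; apply: (@small_sub _ _ _ _ (\bigcup_(i in G a)
    (split_near c e a (x a k i) `&` range (q a' k')))).
  by move=> b [[i Gi bi] qb]; exists i.
apply: (small_bigcup hL) => [|i _]; first exact: Gs.
have [aa'|a'a] := ltP a a'.
  apply: small_sub (qsmall ha' aa') => b [[eta [_ _ /near_lt ba]] [j _ jb]].
  by split=> //; exists k', j.
have [eta etaP] := qy ha' (xy (k := k) (i := i) a'a).
apply: small_sub (small_setU hL etaP
  (small_near_below hL (c := c) einj (a := a) (x := x a k i) (eta0 := eta))).
move=> b [[eta' [ag _ nb]] [j _ jb]].
have [le|lt] := leP eta eta'; last by right; exists eta'.
left; split; last by exists k', j.
by move=> z ze; apply: ag; apply: lt_le_trans ze le.
Qed.

Lemma ladder_ad a k a' k' : Ecf L K a -> Ecf L K a' -> (a, k) <> (a', k') ->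
  small (range (q a k) `&` range (q a' k')).
Proof.
move=> ha ha' ne; have [aa'|a'a|eaa'] := ltgtP a a'.
- apply: small_sub (qsmall ha' aa') => b [[j _ <-] [j' _ jb]].
  by split; [apply: qlt|exists k', j'; rewrite jb].
- apply: small_sub (qsmall ha a'a) => b [[j _ <-] [j' _ jb]].
  by split; [rewrite -jb; apply: qlt|exists k, j].
apply: (@small_sub _ _ _ _ set0); last exact/small_finite.
move=> b [[j _ <-] [j' _]]; rewrite -eaa' => /(qinj ha)[ek _].
by apply: ne; rewrite eaa' ek.
Qed.

Lemma pre_family_ad a k a' k' : Ecf L K a -> Ecf L K a' -> (a, k) <> (a', k') ->
  small (pre_family a k `&` pre_family a' k').
Proof.
move=> ha ha' ne.
apply: (@small_sub _ _ _ _
  (((guess a k `&` guess a' k') `|` (guess a k `&` range (q a' k'))) `|`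
   ((guess a' k' `&` range (q a k)) `|` (range (q a k) `&` range (q a' k'))))).
  by move=> b [[?|?] [?|?]]; [left; left|left; right|right; left|right; right].
apply: small_setU => //; apply: small_setU => //.
- exact: guess_ad.
- exact: guess_ladder_ad.
- exact: guess_ladder_ad.
- exact: ladder_ad.
Qed.

Lemma family_ad a k a' k' : Ecf L K a -> Ecf L K a' -> (a, k) <> (a', k') ->
  small (family a k `&` family a' k').
Proof.
move=> ha ha' /(pre_family_ad ha ha'); apply: small_sub.
by move=> b [[? _] [? _]].
Qed.

Lemma family_disjoint a k k' b : family a k b -> family a k' b -> k = k'.
Proof.
move=> [bk nk] [bk' nk']; have [lt|lt|//] := ltgtP k k'.
- by case: nk'; exists k.
- by case: nk; exists k'.
Qed.

(* [family a k] is [pre_family a k] up to a small, hence bounded, set. *)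
Lemma family_meets a k (B : set K) : Ecf L K a ->
  (forall g, g < a -> exists b, [/\ pre_family a k b, B b & g < b]) ->
  forall g, g < a -> exists b, [/\ family a k b, B b, g < b & b < a].
Proof.
move=> ha pB g ga.
have [||g' g'a g'P] := Ecf_bounded ha
    (A := pre_family a k `&` \bigcup_(l in below k) pre_family a l).
- rewrite setI_bigcupr; apply: small_bigcup => // [|l lk]; first exact: small_below.
  by apply: pre_family_ad => // -[e']; rewrite e' /below /= ltxx in lk.
- by move=> b [/(pre_family_lt ha)].
have [|b [pb Bb]] := pB (Order.max g g'); first by rewrite gt_max ga.
rewrite gt_max => /andP[gb g'b]; exists b; split=> //; last exact: pre_family_lt pb.
split=> // pb'; have := lt_trans (g'P b (conj pb pb')) g'b.
by rewrite ltxx.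
Qed.

(** Here the ladder suffices: it has lambda many points, few of them below a given [g' < a]. *)
Lemma family_unbounded a k : Ecf L K a ->
  forall g, g < a -> exists b, [/\ family a k b, g < b & b < a].
Proof.
move=> ha g ga; have [|b [? _ ? ?]] := family_meets (k := k) (B := setT) ha _ ga;
  last by exists b.
move=> {}g {}ga; apply: contrapT => nb.
have [_ /(_ g ga)[g' gg' g'a]] := Ecf_limit hL ha; apply: (qsmall ha g'a).
apply: (@card_le_fun _ _ _ _ (q a k)) => [j _|j j' _ _ /(qinj ha)[]//].
split; last by exists k, j.
rewrite ltNge; apply/negP => g'j; apply: nb; exists (q a k j); split=> //.
  by right; exists j.
exact: lt_le_trans gg' g'j.
Qed.

Lemma family_cofinal a k : Ecf L K a -> cofinal_in (below a) (family a k).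
Proof.
move=> ha; split=> [b [/(pre_family_lt ha)]//|g /(family_unbounded k ha)].
by move=> [b [bf /ltW gb _]]; exists b.
Qed.

Lemma family_osup a k : Ecf L K a -> osup (family a k) = below a.
Proof.
move=> ha; apply/seteqP; split=> [g [b [/(pre_family_lt ha) ba _] gb]|g].
  exact: lt_trans gb ba.
by move=> /(family_unbounded k ha)[b [bf gb _]]; exists b.
Qed.

End Family.

(** * Coding of the sets of trees and verification of the three clauses *)

(* L is the cardinal lambda, K is lambda^+ *)
Theorem theorem3p5 (d d' : Order.disp_t)
    (L : orderType d) (K : orderType d')
    (hL : infinite_regular_cardinal L) (hK : successor_cardinal L K)
    (hc : exists c : L -> K -> L, tight c /\ strongly_unbounded c)
    (SS : set (set K)) (hSS : stationary_partition SS (Ecf L K)) :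
  clubsuit_ad_star SS L L.
Proof.
case: hc => c [tc suc]; case: hSS => SSs SStriv SSE.
have [k0 _] := succ_inh hK; have [l0 _] := regular_inh hL.
have [e einj] := below_injections hL hK.
have [r rP] := nodes_enum hL hK suc.
have [Tr [TrT Trd]] := tight_enum hL hK tc.
have /choice[qy qyP] : forall a, exists qy : (L -> L -> K) * (L -> L), Ecf L K a ->
  [/\ forall k j k' j', qy.1 k j = qy.1 k' j' -> k = k' /\ j = j',
      forall k j, qy.1 k j < a,
      forall x, x < a -> small L [set b | b < x /\ exists k j, b = qy.1 k j] &
      forall x, ~ (forall z, c z x = qy.2 z) -> exists eta,
        small L [set b | agree c eta b x /\ exists k j, b = qy.1 k j]].
  move=> a; have [ha|na] := pselect (Ecf L K a).
    by have [q [y qyP]] := ladder hL hK c ha; exists (q, y).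
  by exists (fun _ _ => k0, fun=> l0).
pose q a := (qy a).1; pose y a := (qy a).2.
have [x [xb xge xy xx]] := branches_choice hL hK suc TrT y.
have XT T U : [set: T * U] = [set: T] `*` [set: U] by apply/seteqP; split.
have KLK : [set: K * L] #<= [set: K].
  apply: card_le_trans (succ_square hL hK).
  by rewrite !XT; apply: card_leX => //; case: hK => _ /andP[].
have [|dec [_ decs]] := card_le_surjE k0 KLK; first by exists (k0, l0).
have /choice[phi phiP] : forall S, exists phi : K -> K, SS S ->
    forall p, stationary [set a | S a /\ phi a = p].
  move=> S; have [SSS|nS] := pselect (SS S); last by exists id.
  by have [phi phiP] := stationary_split hL hK (SSs S SSS); exists phi.
(* [st a] is the member of the partition containing [a], so [G] can depend on [a] alone. *)
have /choice[st stP] : forall a, exists S, forall S', SS S' -> S' a -> S = S'.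
  move=> a; have [[S SSS Sa]|nS] := pselect (exists2 S, SS S & S a).
    by exists S => S' SS' S'a; apply: SStriv => //; exists a.
  by exists set0 => S' SS' S'a; case: nS; exists S'.
(* [a] carries a code [(p, n)]. Injectivity of [e p] keeps [G a] small, and every small set of
   indices is covered by some code. *)
pose G a : set K := let p := dec (phi (st a) a) in [set i | i < p.1 /\ e p.1 i < p.2].
have Gs a : small L (G a).
  rewrite /G; case: (dec _) => p n /=; apply: small_card_le (small_below hL (k := n)).
  by apply: (@card_le_fun _ _ _ _ (e p)) => [i []//|i j [ip _] [jp _]]; apply: einj.
have SE a : (\bigcup_(S in SS) S) a -> Ecf L K a by rewrite SSE.
have SE' S a : SS S -> S a -> Ecf L K a by move=> SSS Sa; apply: SE; exists S.
have qi a : Ecf L K a -> _ := fun ha => let: And4 h _ _ _ := qyP a ha in h.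
have ql a : Ecf L K a -> _ := fun ha => let: And4 _ h _ _ := qyP a ha in h.
have qs a : Ecf L K a -> _ := fun ha => let: And4 _ _ h _ := qyP a ha in h.
have qz a : Ecf L K a -> _ := fun ha => let: And4 _ _ _ h := qyP a ha in h.
pose F := family c e x G q.
have Fad := family_ad hL einj Gs xy xx qi ql qs qz.
exists (fun a => range (F a)); split.
- move=> a /SE ha _; split.
  + move=> _ _ [k _ <-] [k' _ <-] [b [/= bk bk']].
    by rewrite (family_disjoint bk bk').
  (* The values of [F a] are nonempty and disjoint, hence distinct. *)
  + apply: (@inj_card_eq _ _ setT (F a)) => k k' _ _ kk'.
    have [[g ga] _] := Ecf_limit hL ha.
    have [b [bk _ _]] := family_unbounded hL einj Gs xy xx qi ql qs qz k ha ga.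
    by apply: (family_disjoint bk); rewrite -/(F a) -kk'.
  + by move=> _ [k _ <-]; apply: (family_cofinal hL einj Gs xy xx qi ql qs qz).
- move=> BB BBK /andP[BBL /negP BBs] S SSS C Cc.
  have /choice[ib ibP] : forall B, exists i, BB B -> dense_in c B (Tr i).
    move=> B; have [BBB|nB] := pselect (BB B); last by exists k0.
    have [|i iP] := tight_dense hL hK rP Trd (B := B); last by exists i.
    apply/(unboundedP hL hK) => BL; apply: (succ_not_le hK).
    by have /card_eqPle[_ KB] := BBK B BBB; apply: card_le_trans KB BL.
  (* The pair [(p, n)] codes a set containing all [ib B]; [n] exists because [BB] is small. *)
  have [|p pP] := card_le_bounded hL hK (A := ib @` BB).
    exact: card_le_trans (card_image_le _ _) BBL.
  have [|n nP] := small_bounded hL (A := (fun B => e p (ib B)) @` BB).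
    exact: small_image.
  have [m mE] := decs (p, n) I.
  have [|a [[Sa am] Ca gB]] := guess_unbounded hL hK suc e xb xge (G := G)
      (phiP S SSS m) Cc BBL.
    move=> B BBB; exists (ib B); split; first exact: ibP.
    move=> a [Sa am]; rewrite /G (stP a S) // am mE /=.
    by split; [apply: pP; exists B|apply: nP; exists B].
  have ha := SE' S a SSS Sa.
  exists a; split=> //; split=> // _ B [k _ <-] BBB.
  apply/seteqP; split=> [g [b [bk _] gb]|g ga].
    apply: lt_trans gb _; apply: (pre_family_lt ql (c := c)) (ha) bk.1.
  have [|b [bk Bb gb _]] :=
    family_meets hL einj Gs xy xx qi ql qs qz (k := k) (B := B) ha _ ga; last by exists b.
  move=> {}g {}ga; have [b [gb Bb ltb]] := gB k B BBB g ga.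
  by exists b; split=> //; left.
move=> _ _ [S SSS [a Sa [k _ <-]]] [S' SSS' [a' Sa' [k' _ <-]]] ne.
have ha := SE' _ _ SSS Sa; have ha' := SE' _ _ SSS' Sa'.
(* A cofinal [A] of size lambda represents the cofinality of [osup (F a k)]. *)
have [[A Acof /card_eqPle[AL LA]] cfa] := ha.
exists A.
  rewrite (family_osup hL einj Gs xy xx qi ql qs qz) //; split; first by exists A.
  by move=> A' /cfa; apply: card_le_trans AL.
apply/andP; split.
  apply: card_le_trans LA; apply: card_le_trans (below_card hK a).
  by apply: subset_card_le => b [[/(pre_family_lt ql ha)]].
apply/negP => AF; apply: (Fad a k a' k') => //; last exact: card_le_trans LA AF.
by move=> [eaa' ekk']; apply: ne; rewrite eaa' ekk'.
Qed.
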